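(* Let $d\ge 1$, let $S\in\mathbb{R}^{d\times d}$ be a constant skew-symmetric matrix, let $H:\mathbb{R}^d\to\mathbb{R}$ be a homogeneous cubic polynomial, and let $\Delta t>0$. Let the polarised energy be $$\tilde H(x,y)=\frac16\,x^T H''\Bigl(\frac{x+y}{2}\Bigr)y ,\qquad x,y\in\mathbb{R}^d,$$ and let $\overline{\nabla}\tilde H(x,y,z)=2\,\nabla_x\tilde H\bigl(\tfrac{x+z}{2},y\bigr)$. Then the polarised discrete gradient scheme $$\frac{x^{n+2}-x^n}{2\Delta t}=S\,\overline{\nabla}\tilde H(x^n,x^{n+1},x^{n+2})$$ for the ODE $\dot x=S\nabla H(x)$ is equivalent to the scheme $$\frac{x^{n+2}-x^n}{2\Delta t}=S\sum_{i,j=1}^3\alpha_{ij}\bigl(H''(x^{n-1+i})x^{n-1+j}+\beta(x^{n-1+i})\bigr)$$ with $\alpha_{21}=\alpha_{22}=\alpha_{23}=\tfrac16$ and $\alpha_{ij}=0$ otherwise, i.e. to $$\frac{x^{n+2}-x^n}{2\Delta t}=\frac16\,S\,H''(x^{n+1})(x^n+x^{n+1}+x^{n+2}).$$ Here equivalent means that any $x^n,x^{n+1},x^{n+2}\in\mathbb{R}^d$ satisfy one scheme if and only if they satisfy the other.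
   Context: $H''(x)\in\mathbb{R}^{d\times d}$ denotes the Hessian matrix of $H$ at $x$, and $\beta(x):=2\nabla H(x)-H''(x)x$ (which vanishes identically when $H$ is a homogeneous cubic). $\nabla_x\tilde H(x,y)$ denotes the gradient of $\tilde H$ with respect to its first argument; $\nabla_x\tilde H(\tfrac{x+z}{2},y)$ is this gradient evaluated at the point $(\tfrac{x+z}{2},y)$. Superscripts on $x$ are time-step indices. *)

(* Defs.v *)
From HB Require Import structures.
From mathcomp Require Import all_boot all_order all_algebra.
From mathcomp Require Import boolp classical_sets reals topology normedtype derive.
(* The notations of mpoly clash with those of MathComp-Analysis:
   [mpoly d R] is {mpoly R[d]}, [p \is ishomog1 k mdeg] is p \is k.-homog and
   [meval v p] is p.@[v]. *)
From mathcomp Require Import -(notations) mpoly.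
Import numFieldNormedType.Exports.
Import GRing.Theory Num.Theory.
Set Implicit Arguments.
Unset Strict Implicit.
Unset Printing Implicit Defensive.
Local Open Scope ring_scope.

(* As usual, the zero polynomial counts as homogeneous of every degree. *)
Definition homogeneous_cubic (R : realType) (d : nat) (H : 'cV[R]_d -> R) : Prop :=
  exists2 p : mpoly d R,
    p \is ishomog1 3 mdeg & forall x, H x = meval (fun i => x i 0) p.

Definition gradient (R : realType) (d : nat) (f : 'cV[R]_d -> R) (x : 'cV[R]_d) :
    'cV[R]_d :=
  \col_i 'D_(delta_mx i 0) f x.

Definition hessian (R : realType) (d : nat) (f : 'cV[R]_d -> R) (x : 'cV[R]_d) :
    'M[R]_d :=
  \matrix_(i, j) 'D_(delta_mx i 0) ('D_(delta_mx j 0) f) x.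

Definition beta (R : realType) (d : nat) (H : 'cV[R]_d -> R) (x : 'cV[R]_d) :
    'cV[R]_d :=
  2 *: gradient H x - hessian H x *m x.

(* The product is a 1 x 1 matrix, read as a scalar through its only entry. *)
Definition polarised_energy (R : realType) (d : nat) (H : 'cV[R]_d -> R)
    (x y : 'cV[R]_d) : R :=
  6^-1 * (x^T *m hessian H (2^-1 *: (x + y)) *m y) 0 0.

Definition polarised_discrete_gradient (R : realType) (d : nat)
    (Ht : 'cV[R]_d -> 'cV[R]_d -> R) (x y z : 'cV[R]_d) : 'cV[R]_d :=
  2 *: gradient (fun u => Ht u y) (2^-1 *: (x + z)).

(* In the schemes, x0, x1, x2 stand for x^n, x^(n+1), x^(n+2). *)

Definition polarised_dg_scheme (R : realType) (d : nat) (S : 'M[R]_d)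
    (H : 'cV[R]_d -> R) (dt : R) (x0 x1 x2 : 'cV[R]_d) : Prop :=
  (2 * dt)^-1 *: (x2 - x0) =
  S *m polarised_discrete_gradient (polarised_energy H) x0 x1 x2.

(* Indices in 'I_3 start at 0: the entry (i, j) of a is alpha_(i+1)(j+1), and
   X i is x^(n-1+(i+1)) = x^(n+i). *)
Definition alpha_scheme (R : realType) (d : nat) (S : 'M[R]_d)
    (H : 'cV[R]_d -> R) (a : 'M[R]_3) (dt : R) (x0 x1 x2 : 'cV[R]_d) : Prop :=
  let X (i : 'I_3) := tnth [tuple x0; x1; x2] i in
  (2 * dt)^-1 *: (x2 - x0) =
  S *m \sum_(i < 3) \sum_(j < 3)
         a i j *: (hessian H (X i) *m X j + beta H (X i)).

(* alpha_21 = alpha_22 = alpha_23 = 1/6, the other coefficients are 0. *)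
Definition alpha_middle (R : realType) : 'M[R]_3 :=
  \matrix_(i < 3, j < 3) (if i == 1%N :> nat then 6^-1 else 0).

(* Main.v *)
Require Import Defs.
From mathcomp Require Import all_boot all_order all_algebra.
From mathcomp Require Import boolp classical_sets reals topology normedtype derive.
From mathcomp Require Import -(notations) mpoly.
From mathcomp Require Import ring.
Import numFieldNormedType.Exports.
Import GRing.Theory Num.Theory.
Local Open Scope ring_scope.

(* A cubic form is the diagonal of a symmetric trilinear form, H x = T x x x.
   Then the gradient of H at x is 3 T x x _ and its Hessian is 6 T x _ _, so that
   beta = 0 and the polarised energy of x and y is (T x x y + T x y y) / 2.  Its
   polarised discrete gradient at (x, y, z) is therefore
   T (x + z) y _ + T y y _ = T y (x + y + z) _, that is H''(y)(x + y + z) / 6. *)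

Record symmetric_trilinear {R : realType} {d : nat}
    (T : 'cV[R]_d -> 'cV[R]_d -> 'cV[R]_d -> R) : Prop := SymmetricTrilinear {
  trilinearP : forall a x x' y z, T (a *: x + x') y z = a * T x y z + T x' y z;
  trilinear12 : forall x y z, T x y z = T y x z;
  trilinear23 : forall x y z, T x y z = T x z y }.

(** A nonzero degree forces some positive exponent, so one variable can be split off, lowering the
    degree by one. Two such splittings leave degree 1, which is a single variable. The three indices
    may coincide. *)
Lemma deg3_mnmE (d : nat) (m : multinom d) : mdeg m = 3 ->
  exists i j k, m = mnm_add (mnm1 i) (mnm_add (mnm1 j) (mnm1 k)).
Proof.
have peel n (m' : multinom d) : mdeg m' = n.+1 ->
    exists i m'', m' = mnm_add (mnm1 i) m'' /\ mdeg m'' = n.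
  move=> dm'.
  have [i m'i] : exists i, m' i != 0%N.
    apply/existsP; apply: contra_eqT dm' => /existsPn m'0.
    by rewrite mdegE big1 // => i _; apply/eqP; have := m'0 i; rewrite negbK.
  have e : m' = mnm_add (mnm1 i) (mnm_sub m' (mnm1 i)).
    by rewrite addmC submK // lep1mP.
  exists i, (mnm_sub m' (mnm1 i)); split=> //.
  by apply: succn_inj; rewrite -dm' [in RHS]e mdegD mdeg1.
move=> /peel[i [m1 [-> /peel[j [m2 [-> /eqP]]]]]].
by rewrite mdeg_eq1 => /existsP[k /eqP->]; exists i, j, k.
Qed.

(** Diagonals of symmetric trilinear forms contain 0 and are closed under addition, so it suffices
    to treat one monomial with its coefficient. *)
Lemma homogeneous_cubic_trilinear {R : realType} {d : nat} {H : 'cV[R]_d -> R} :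
  homogeneous_cubic H ->
  exists2 T, symmetric_trilinear T & forall x, H x = T x x x.
Proof.
case=> p /dhomogP hp HE.
suff [T symT TE] : exists2 T, symmetric_trilinear T &
    forall x : 'cV[R]_d, meval (fun i => x i 0) p = T x x x.
  by exists T => // x; rewrite HE TE.
(* [big_seq] records that each monomial lies in the support of [p], where [hp] forces degree 3. *)
rewrite (mpolyE p) big_seq.
apply: (big_ind (fun q => exists2 T, symmetric_trilinear T &
    forall x : 'cV[R]_d, meval (fun i => x i 0) q = T x x x)).
- exists (fun _ _ _ => 0); last by move=> x; rewrite meval0.
  by split=> // *; rewrite mulr0 addr0.
- move=> q1 q2 [T1 [l1 s1 t1] E1] [T2 [l2 s2 t2] E2].
  exists (fun x y z => T1 x y z + T2 x y z); last first.
    by move=> x; rewrite mevalD E1 E2.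
  split=> [a x x' y z|x y z|x y z].
  + by rewrite l1 l2; ring.
  + by rewrite s1 s2.
  + by rewrite t1 t2.
move=> m /hp /deg3_mnmE[i [j [k ->]]].
set c := mcoeff _ _.
pose t (x y z : 'cV[R]_d) := x i 0 * (y j 0 * z k 0).
(* Averaging [t] over the six permutations of its arguments makes it symmetric; on the diagonal the
   six terms agree, so the value is that of [t] times [c]. *)
exists (fun x y z => c / 6 * (t x y z + t x z y + t y x z + t y z x
                              + t z x y + t z y x)).
  by split=> [a x x' y z|x y z|x y z]; rewrite /t ?mxE; ring.
move=> x; rewrite mevalZ !mpolyXD !mevalM !mevalXU /t.
by field.
Qed.

(** For nonzero [h] the difference quotient is exactly [q h], and continuity of [q] at 0 gives its
    limit. *)
Lemma derive_along_line {R : realType} {V : normedModType R} (f : V -> R)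
    (x v : V) (q : R -> R) :
  {for 0, continuous q} -> (forall h, f (h *: v + x) = f x + h * q h) ->
  'D_v f x = q 0.
Proof.
move=> /continuous_withinNx cq fE; apply/cvg_lim => //.
apply: cvg_trans cq; apply: near_eq_cvg; near=> h.
have h0 : h != 0 by near: h; exact: nbhs_dnbhs_neq.
by rewrite /= fE addrC addKr /GRing.scale /= mulKf.
Unshelve. all: by end_near. Qed.

(** Every function differentiated below is a polynomial of degree at most 3 along lines, so each
    derivative is read off as the coefficient of [h]. *)
Lemma derive_cubic_line {R : realType} {V : normedModType R} (f : V -> R)
    (x v : V) (a b c : R) :
  (forall h, f (h *: v + x) = f x + h * (a + h * b + h ^+ 2 * c)) ->
  'D_v f x = a.
Proof.
move=> fE; rewrite (derive_along_line f x v (fun h => a + h * b + h ^+ 2 * c)) //.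
  by ring.
apply: cvgD; [apply: cvgD|]; first exact: cvg_cst.
- by apply: cvgM; [exact: cvg_id|exact: cvg_cst].
- by apply: cvgM; [rewrite expr2; apply: cvgM; exact: cvg_id|exact: cvg_cst].
Qed.

Section CubicForm.
Context {R : realType} {d : nat} {T : 'cV[R]_d -> 'cV[R]_d -> 'cV[R]_d -> R}.
Hypothesis symT : symmetric_trilinear T.

Let T1 := trilinearP _ symT.
Let T12 := trilinear12 _ symT.
Let T23 := trilinear23 _ symT.

Lemma trilinear2P a x y y' z : T x (a *: y + y') z = a * T x y z + T x y' z.
Proof. by rewrite T12 T1 !(T12 x). Qed.

Lemma trilinear3P a x y z z' : T x y (a *: z + z') = a * T x y z + T x y z'.
Proof. by rewrite T23 trilinear2P !(T23 x y). Qed.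

(** Expanding [z] in the standard basis is what converts matrix products with the Hessian into
    values of [T]. *)
Lemma trilinear3_sum x y z : T x y z = \sum_i T x y (delta_mx i 0) * z i 0.
Proof.
have T0 : T x y 0 = 0.
  by have := trilinear3P (-1) x y 0 0; rewrite scaler0 addr0 mulN1r addNr.
have TD : {morph T x y : u v / u + v}.
  by move=> u v; have := trilinear3P 1 x y u v; rewrite scale1r mul1r.
have TZ a u : T x y (a *: u) = a * T x y u.
  by have := trilinear3P a x y u 0; rewrite addr0 T0 addr0.
rewrite {1}[z]matrix_sum_delta (big_morph _ TD T0).
by apply: eq_bigr => i _; rewrite big_ord1 TZ mulrC.
Qed.

Context {H : 'cV[R]_d -> R}.
Hypothesis HE : forall x, H x = T x x x.

Lemma derive_cubic_form x v : 'D_v H x = 3 * T x x v.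
Proof.
apply: (derive_cubic_line H x v _ (3 * T x v v) (T v v v)) => h.
rewrite !HE !(T1, trilinear2P, trilinear3P).
rewrite (T12 v x x) (T23 x v x) (T12 v x v) (T23 v v x) (T12 v x v).
by ring.
Qed.

Lemma derive2_cubic_form x u v : 'D_u ('D_v H) x = 6 * T x u v.
Proof.
apply: (derive_cubic_line ('D_v H) x u _ (3 * T u u v) 0) => h.
rewrite !derive_cubic_form !(T1, trilinear2P) (T12 u x v).
by ring.
Qed.

Lemma hessian_cubic_form_mul x y i :
  (hessian H x *m y) i 0 = 6 * T x (delta_mx i 0) y.
Proof.
rewrite mxE trilinear3_sum mulr_sumr; apply: eq_bigr => j _.
by rewrite mxE derive2_cubic_form mulrA.
Qed.

Lemma beta_cubic_form x : beta H x = 0.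
Proof.
apply/matrixP => i j; rewrite ord1 /beta.
rewrite mxE [X in X + _]mxE [X in _ + X]mxE hessian_cubic_form_mul !mxE.
by rewrite derive_cubic_form (T23 x x); ring.
Qed.

Lemma polarised_energy_cubic_form x y :
  polarised_energy H x y = 2^-1 * (T x x y + T x y y).
Proof.
rewrite /polarised_energy -mulmxA mxE.
under eq_bigr => i _ do rewrite mxE hessian_cubic_form_mul.
have -> : \sum_i x i 0 * (6 * T (2^-1 *: (x + y)) (delta_mx i 0) y) =
    6 * T (2^-1 *: (x + y)) y x.
  by rewrite trilinear3_sum mulr_sumr; apply: eq_bigr => i _; rewrite T23; ring.
(* Adding 0 gives the second summand the shape that [T1] expects; the leftover term [T 0 y x]
   vanishes. *)
rewrite scalerDr T1 -[2^-1 *: y]addr0 T1.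
have -> : T 0 y x = 0.
  by have := T1 (-1) 0 0 y x; rewrite scaler0 addr0 mulN1r addNr.
by rewrite addr0 (T23 x y x) (T23 y y x) (T12 y x y); field.
Qed.

Lemma polarised_discrete_gradient_cubic_form x y z :
  polarised_discrete_gradient (polarised_energy H) x y z =
  6^-1 *: (hessian H y *m (x + y + z)).
Proof.
apply/matrixP => i j; rewrite ord1 mxE [RHS]mxE hessian_cubic_form_mul mxE.
set e := delta_mx i 0; set u := _ *: (x + z).
(* With [y] fixed, the energy is quadratic in its first argument, so the coefficient of [h ^+ 3] is
   0. *)
rewrite (derive_cubic_line _ u e (T u y e + 2^-1 * T y y e) (2^-1 * T e e y) 0).
  have xyzE : x + y + z = 2 *: u + y.
    by rewrite scalerA mulfV ?pnatr_eq0 // scale1r addrAC.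
  rewrite xyzE trilinear3P (T23 y e u) (T12 y u e) (T23 y e y).
  by field.
move=> h; rewrite !polarised_energy_cubic_form !(T1, trilinear2P).
rewrite (T12 e u y) (T23 u e y) (T12 e y y) (T23 y e y).
by field.
Qed.

Lemma alpha_middle_sum_cubic_form (X : 'I_3 -> 'cV[R]_d) :
  \sum_(i < 3) \sum_(j < 3)
     alpha_middle R i j *: (hessian H (X i) *m X j + beta H (X i)) =
  6^-1 *: (hessian H (X 1) *m \sum_j X j).
Proof.
(* Only the middle row, of index 1 when counting from 0, has nonzero coefficients. *)
rewrite (bigD1 (1 : 'I_3)) //= [X in _ + X]big1 ?addr0 => [|i].
  rewrite mulmx_sumr scaler_sumr; apply: eq_bigr => j _.
  by rewrite beta_cubic_form addr0 mxE.
rewrite -val_eqE /= => /negPf i1.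
by rewrite big1 // => j _; rewrite mxE i1 scale0r.
Qed.

End CubicForm.

Theorem theorem2 (R : realType) (d : nat) (hd : (1 <= d)%N) (S : 'M[R]_d)
    (hS : S^T = - S) (H : 'cV[R]_d -> R) (hH : homogeneous_cubic H)
    (dt : R) (hdt : 0 < dt) :
  forall x0 x1 x2 : 'cV[R]_d,
    (polarised_dg_scheme S H dt x0 x1 x2 <->
     alpha_scheme S H (alpha_middle R) dt x0 x1 x2)
    /\
    (alpha_scheme S H (alpha_middle R) dt x0 x1 x2 <->
     (2 * dt)^-1 *: (x2 - x0) =
     6^-1 *: (S *m hessian H x1 *m (x0 + x1 + x2))).
Proof.
move=> x0 x1 x2; have [T symT HE] := homogeneous_cubic_trilinear hH.
rewrite /polarised_dg_scheme /alpha_scheme.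
rewrite (polarised_discrete_gradient_cubic_form symT HE).
rewrite (alpha_middle_sum_cubic_form symT HE).
by rewrite !big_ord_recr big_ord0 /= add0r -scalemxAr mulmxA.
Qed.
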